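(* Let $t\ge t_*$ and let $\hat u$ be an arbitrary minimizer of $E_t^{1,1}(\cdot;f)$ fulfilling $A\hat u\ne f$. Then $$\{Au: u\in\operatorname{argmin}E_t^{1,1}(\cdot;f)\}\subset\{f+c(A\hat u-f): c\ge0\}.$$
   Context: Setting: $\mathcal X$ is the (real) Banach space dual of a separable Banach space $\mathcal Y$; $\mathcal H$ is a real Hilbert space; $A:\mathcal X\to\mathcal H$ is bounded and linear, with adjoint $A^*:\mathcal H\to\mathcal X^*$, $\langle A^*q,u\rangle=\langle q,Au\rangle$. $J:\mathcal X\to[0,\infty]$ is convex, proper, weak$^*$ lower semi-continuous and absolutely one-homogeneous ($J(cu)=|c|J(u)$). $\mathcal N(J)=\{u:J(u)=0\}$, $\mathrm{dom}(J)=\{u:J(u)<\infty\}$, and $\partial J(u)=\{p\in\mathcal X^*: J(u)+\langle p,v-u\rangle\le J(v)\ \forall v\in\mathcal X\}$. The datum $f\in\mathcal H$ is such that any $u\in\mathcal X$ with $Au=f$ satisfies $J(u)\ne 0$. $E_t^{1,1}(u;f)=\|Au-f\|_{\mathcal H}+tJ(u)$ for $u\in\mathcal X$ (with value $+\infty$ if $J(u)=\infty$). Standing assumptions: (1) $u\mapsto\|Au\|_{\mathcal H}$ is a norm on $\mathcal N(J)$ equivalent to the restriction of $\|\cdot\|_{\mathcal X}$. (2) There is $C>0$ with $\|u-\mathcal P^A(Au)\|_{\mathcal X}\le C J(u)$ for all $u\in\mathcal X$, where $\mathcal P^A(g)$ denotes the (unique) minimizer of $\|Au-g\|_{\mathcal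 H}$ over $u\in\mathcal N(J)$, $g\in\mathcal H$. (3) $A$ is weak$^*$-to-weak continuous. Definition of $t_*$: if there are $u^\dagger\in\mathrm{dom}(J)$ with $Au^\dagger=f$ and $q\in\mathcal H$ with $A^*q\in\partial J(u^\dagger)$, put $t_*:=1/s_*$, where $s_*:=\inf\{\|q\|_{\mathcal H}: q\in\mathcal H,\ A^*q\in\partial J(u)\text{ for some }u\in\mathrm{dom}(J)\text{ with }Au=f\}\in(0,\infty)$; otherwise $t_*:=0$. *)

(* Defs.v *)
From HB Require Import structures.
From mathcomp Require Import all_boot all_order all_algebra.
From mathcomp Require Import all_classical all_reals all_analysis.
Import Order.TTheory GRing.Theory Num.Theory.
Import numFieldNormedType.Exports.

Set Implicit Arguments.
Unset Strict Implicit.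
Unset Printing Implicit Defensive.

Local Open Scope classical_set_scope.
Local Open Scope ring_scope.

Definition separable_space (T : topologicalType) : Prop :=
  exists2 D : set T, countable D & dense D.

(* X is the Banach space dual of Y: u |-> pairing u is an isometric linear
   isomorphism of X onto the space of continuous linear functionals on Y with
   the operator norm. *)
Definition is_dual_of (R : realType) (X Y : normedModType R)
    (pairing : {bilinear X -> Y -> R | *%R & *%R}) : Prop :=
  [/\ forall u : X, continuous (pairing u : Y -> R),
      forall u : X,
        `|u|%:E = ereal_sup [set `|pairing u y|%:E | y in [set y : Y | `|y| <= 1]] &
      forall phi : {linear Y -> R^o}, continuous phi ->
        exists u : X, forall y : Y, pairing u y = phi y].

Definition weak_star_space (R : realType) (X Y : normedModType R)
    (pairing : {bilinear X -> Y -> R | *%R & *%R}) : topologicalType :=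
  initial_topology ((fun u y => pairing u y) : X -> {ptws Y -> R}).

(* V^* : the continuous linear functionals on V. *)
Definition top_dual (R : realType) (V : normedModType R) : set (V -> R) :=
  [set p | linear (p : V -> R^o) /\ continuous p].

Definition weak_space (R : realType) (V : normedModType R) : topologicalType :=
  initial_topology
    ((fun x p => (val p : V -> R) x) : V -> {ptws set_type (@top_dual R V) -> R}).

(* The norm of H is the one of the inner product; together with the completeness
   of H this makes H a real Hilbert space. *)
Definition hilbert_norm (R : realType) (H : normedModType R)
    (ip : {dot H for idfun}) : Prop :=
  forall x : H, `|x| = Num.sqrt (ip x x).

Definition bounded_operator (R : realType) (V W : normedModType R)
    (A : V -> W) : Prop :=
  exists M : R, forall u : V, `|A u| <= M * `|u|.

Definition adjoint (R : realType) (X H : normedModType R)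
    (ip : {dot H for idfun}) (A : X -> H) (q : H) : X -> R :=
  fun u => ip q (A u).

Definition is_norm_on (R : realType) (V : normedModType R) (N : set V)
    (p : V -> R) : Prop :=
  [/\ forall u, N u -> 0 <= p u,
      forall u v, N u -> N v -> p (u + v) <= p u + p v,
      forall c u, N u -> p (c *: u) = `|c| * p u &
      forall u, N u -> p u = 0 -> u = 0].

Definition equivalent_on (R : realType) (V : normedModType R) (N : set V)
    (p q : V -> R) : Prop :=
  exists c C : R, [/\ 0 < c, 0 < C &
    forall u, N u -> c * q u <= p u /\ p u <= C * q u].

Definition argmin (R : realType) (T : Type) (F : T -> \bar R) : set T :=
  [set u | forall v, (F u <= F v)%E].

Section Functional.
Variables (R : realType) (X : normedModType R).
Implicit Type J : X -> \bar R.
Local Open Scope ereal_scope.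

(* In \bar R one has 0 * +oo = 0, the convention used in the next two
   definitions. *)
Definition convex_functional J : Prop :=
  forall (l : R) (u v : X), (0 <= l <= 1)%R ->
    J (l *: u + (1 - l) *: v)%R <= l%:E * J u + (1 - l)%:E * J v.

Definition abs_one_homogeneous J : Prop :=
  forall (c : R) (u : X), J (c *: u)%R = `|c|%:E * J u.

Definition effective_domain J : set X := [set u | J u < +oo].

Definition null_space J : set X := [set u | J u = 0].

Definition proper_functional J : Prop := effective_domain J !=set0.

Definition subdifferential J (u : X) : set (X -> R) :=
  [set p | @top_dual R X p /\ forall v, J u + (p (v - u)%R)%:E <= J v].

End Functional.

Section Energy.
Variables (R : realType) (X H : normedModType R) (ip : {dot H for idfun}).
Variables (A : X -> H) (J : X -> \bar R).

(* P^A g: the minimizer of |A u - g| over N(J). The default value 0 of xget is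
   irrelevant when this minimizer exists and is unique. *)
Definition PA (g : H) : X :=
  xget 0 [set u | null_space J u /\
                  forall v, null_space J v -> `|A u - g| <= `|A v - g|].

(* The case distinction matters at t = 0, where t%:E * +oo would be 0. *)
Definition energy (t : R) (f : H) (u : X) : \bar R :=
  if J u == +oo%E then +oo%E else (`|A u - f|%:E + t%:E * J u)%E.

Definition source_elements (f : H) : set H :=
  [set q | exists u, [/\ effective_domain J u, A u = f &
                         subdifferential J u (adjoint ip A q)]].

Definition s_star (f : H) : R := inf [set `|q| | q in source_elements f].

Definition t_star (f : H) : R :=
  if `[< source_elements f !=set0 >] then (s_star f)^-1 else 0.

End Energy.

(* Main.v *)
Require Import Defs.
From HB Require Import structures.
From mathcomp Require Import all_boot all_order all_algebra.
From mathcomp Require Import all_classical all_reals all_analysis.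
From mathcomp Require Import ring lra.
Import Order.TTheory GRing.Theory Num.Theory.
Import numFieldNormedType.Exports.
Local Open Scope classical_set_scope.
Local Open Scope ring_scope.

(** The set of residuals [A u - f] of minimizers lies on one ray because the
    Hilbert norm is strictly convex.  If [u] and [v] both minimize
    [|A u - f| + t J u], then so does their midpoint, by convexity of both
    terms; hence neither term can gain at the midpoint, and for the first term
    this says that the triangle inequality
    [|(A u - f) + (A v - f)| <= |A u - f| + |A v - f|] is an equality
    ([argmin_energy_residual_normD]).  In an inner product space equality holds
    only for vectors on a common ray from the origin ([hilbert_normD_eq]).  As
    [A v - f] is nonzero for [v = uhat], the other residual is a nonnegative
    multiple of it.

    The lower bound on [t] enters through its consequence [0 <= t], which makes
    [t J] convex. *)

Lemma hilbert_norm_sqr (R : realType) (H : normedModType R)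
    (ip : {dot H for idfun}) (x : H) :
  hilbert_norm ip -> `|x| ^+ 2 = ip x x.
Proof.
move=> hn; rewrite hn sqr_sqrtr//.
have [->|x0] := eqVneq x 0; first by rewrite linear0l.
by rewrite ltW// neq0_dnorm_gt0.
Qed.

(** Squaring the hypothesis gives [ip a b = |a| |b|], the equality case of
    Cauchy-Schwarz, so the difference of the two sides of the conclusion has
    squared norm [2 |a| |b| (|a| |b| - ip a b) = 0]. *)
Lemma hilbert_normD_eq (R : realType) (H : normedModType R)
    (ip : {dot H for idfun}) (a b : H) :
  hilbert_norm ip -> `|a + b| = `|a| + `|b| -> `|b| *: a = `|a| *: b.
Proof.
move=> hn abD.
have sqr x := hilbert_norm_sqr _ _ ip x hn.
have ipC : ip b a = ip a b by rewrite hermC expr0 mul1r.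
have ipab : ip a b = `|a| * `|b|.
  have := sqr (a + b).
  rewrite abD linearDl !linearDr /= -!sqr ipC; nra.
apply/eqP; rewrite -subr_eq0 -normr_eq0 -sqrf_eq0 sqr.
rewrite linearBl !linearBr /= !linearZl_LR !linearZr_LR /= -!sqr ipC ipab.
by apply/eqP; rewrite /GRing.scale /=; ring.
Qed.

Section Minimizers.
Variables (R : realType) (X H : normedModType R) (ip : {dot H for idfun}).
Variables (A : {linear X -> H}) (J : X -> \bar R) (t : R) (f : H).

Lemma t_star_ge0 : 0 <= t_star ip A J f.
Proof.
rewrite /t_star; case: asboolP => // -[q q_src].
rewrite invr_ge0; apply: lb_le_inf; first by exists `|q|, q.
by move=> _ [p _ <-].
Qed.

Lemma energy_fin (u : X) (j : R) : J u = j%:E ->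
  energy A J t f u = (`|A u - f| + t * j)%:E.
Proof. by rewrite /energy => ->. Qed.

Hypothesis J_ge0 : forall u : X, (0 <= J u)%E.

Lemma argmin_energy_fin (u : X) : proper_functional J ->
  argmin (energy A J t f) u -> J u \is a fin_num.
Proof.
move=> [v]; rewrite /effective_domain/= => Jv /(_ v).
have Jv_fin : J v \is a fin_num by rewrite ge0_fin_numE.
rewrite (energy_fin v (fine (J v))) ?fineK// {1}/energy.
case: eqP => [_|/eqP Ju _]; first by rewrite leye_eq.
by rewrite ge0_fin_numE// ltey.
Qed.

(** The energy of [w = (u + v) / 2] is at most the mean of the energies of
    [u] and [v], with a gap of at least
    [(|A u - f| + |A v - f| - |(A u - f) + (A v - f)|) / 2]; minimality of [u]
    and [v] forces this gap to vanish. *)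
Lemma argmin_energy_residual_normD (u v : X) :
  convex_functional J -> proper_functional J -> 0 <= t ->
  argmin (energy A J t f) u -> argmin (energy A J t f) v ->
  `|(A u - f) + (A v - f)| = `|A u - f| + `|A v - f|.
Proof.
move=> J_convex J_proper t0 u_min v_min.
have Ju := fineK (argmin_energy_fin u J_proper u_min).
have Jv := fineK (argmin_energy_fin v J_proper v_min).
set ju := fine (J u) in Ju; set jv := fine (J v) in Jv.
pose w := 2^-1 *: u + (1 - 2^-1) *: v.
have half01 : 0 <= (2^-1 : R) <= 1 by apply/andP; split; lra.
have := J_convex _ u v half01; rewrite -/w -Ju -Jv -!EFinM -EFinD => Jw_le.
have Jw : (fine (J w))%:E = J w.
  by rewrite fineK// ge0_fin_numE// (le_lt_trans Jw_le) ?ltry.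
set jw := fine (J w) in Jw; move: Jw_le; rewrite -Jw lee_fin => Jw_le.
have Aw : `|A w - f| = 2^-1 * `|(A u - f) + (A v - f)|.
  have -> : 2^-1 * `|(A u - f) + (A v - f)| =
            `|2^-1 *: ((A u - f) + (A v - f))|.
    by rewrite normrZ ger0_norm// invr_ge0.
  congr (`|_|); rewrite linearD !linearZ/=.
  have -> : 1 - 2^-1 = 2^-1 :> R by lra.
  rewrite addrACA -opprD scalerBr scalerDr; congr (_ - _).
  by rewrite -mulr2n -[f *+ 2]scaler_nat scalerA mulVf ?scale1r ?pnatr_eq0.
have uw := u_min w; have vw := v_min w.
move: uw vw.
rewrite (energy_fin u ju)// (energy_fin v jv)// (energy_fin w jw)// !lee_fin Aw.
have tJ : t * jw <= t * (2^-1 * ju + (1 - 2^-1) * jv) by rewrite ler_wpM2l.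
have := ler_normD (A u - f) (A v - f).
move=> tri uw vw; apply/eqP; rewrite eq_le tri/=; lra.
Qed.

End Minimizers.

Theorem theorem2p17 (R : realType)
  (Y X H : completeNormedModType R)
  (pairing : {bilinear X -> Y -> R | *%R & *%R})
  (ip : {dot H for idfun})
  (A : {linear X -> H})
  (J : X -> \bar R)
  (f : H)
  (Y_separable : separable_space Y)
  (X_dual : is_dual_of pairing)
  (H_hilbert : hilbert_norm ip)
  (A_bounded : bounded_operator A)
  (J_ge0 : forall u : X, (0 <= J u)%E)
  (J_convex : convex_functional J)
  (J_proper : proper_functional J)
  (J_lsc : @lower_semicontinuous (weak_star_space pairing) R J)
  (J_homogeneous : abs_one_homogeneous J)
  (f_datum : forall u : X, A u = f -> J u <> 0%E)
  (A_norm : is_norm_on (null_space J) (fun u => `|A u|))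
  (A_norm_equivalent : equivalent_on (null_space J) (fun u => `|A u|) (fun u => `|u|))
  (PA_bound : exists2 C : R, 0 < C &
     forall u : X, (`|u - PA A J (A u)|%:E <= C%:E * J u)%E)
  (A_weak : continuous (A : weak_star_space pairing -> @weak_space R H))
  (t : R) (ht : t_star ip A J f <= t)
  (uhat : X) (uhat_min : argmin (energy A J t f) uhat)
  (uhat_neq : A uhat <> f) :
  A @` argmin (energy A J t f) `<=`
    [set f + c *: (A uhat - f) | c in [set c : R | 0 <= c]].
Proof.
have t0 : 0 <= t := le_trans (t_star_ge0 R X H ip A J f) ht.
move=> _ [u u_min <-].
have residuals_on_ray := hilbert_normD_eq R H ip _ _ H_hilbert
  (argmin_energy_residual_normD R X H A J t f J_ge0 u uhat
     J_convex J_proper t0 u_min uhat_min).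
have r_neq0 : `|A uhat - f| != 0.
  by rewrite normr_eq0 subr_eq0; apply/eqP.
exists (`|A u - f| / `|A uhat - f|); first exact: divr_ge0.
by rewrite mulrC -scalerA -residuals_on_ray scalerA mulVf// scale1r addrC subrK.
Qed.
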